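(* Consider a smooth solution of the reduced one-velocity, one-pressure $N$-phase model described in the context. Let the mixture entropy $s$ be defined by $\rho s=\sum_{k=1}^N \alpha_k\rho_k s_k$, and split its material derivative as $$\rho\frac{\mathrm{D}s}{\mathrm{D}t}=\rho\frac{\mathrm{D}^{(ext)}s}{\mathrm{D}t}+\rho\frac{\mathrm{D}^{(int)}s}{\mathrm{D}t},\qquad \rho\frac{\mathrm{D}^{(ext)}s}{\mathrm{D}t}=-\sum_{k=1}^N\nabla\cdot\Big(\frac{\boldsymbol{q}_k}{T_k}\Big),$$ where the first part is the entropy variation due to the heat flux and the second part is the internal entropy production. Then the internal entropy production is non-negative: $$\rho\frac{\mathrm{D}^{(int)}s}{\mathrm{D}t}\ \ge\ 0 .$$
   Context: There are $N$ phases, indexed by $k=1,\dots,N$, in three space dimensions. Phase $k$ has volume fraction $\alpha_k>0$ with $\sum_k\alpha_k=1$, phase density $\rho_k>0$, temperature $T_k>0$, specific internal energy $e_k$ and specific entropy $s_k$. All phases share a common velocity $\boldsymbol{u}$ and a common pressure $p$. The mixture density is $\rho=\sum_k\alpha_k\rho_k$. The material derivative is $\frac{\mathrm{D}}{\mathrm{D}t}=\frac{\partial}{\partial t}+\boldsymbol{u}\cdot\nabla$. The Gibbs relation is $T_k\,\mathrm{d}s_k=\mathrm{d}e_k-\frac{p}{\rho_k^2}\,\mathrm{d}\rho_k$. The model is the limit of instantaneous velocity and pressure relaxation of a Baer-Nunziato type model. In this limit the phase mass balances and the phase entropy balances are $$\frac{\partial(\alpha_k\rho_k)}{\partial t}+\nabla\cdot(\alpha_k\rho_k\boldsymbol{u})=0,\qquad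 \alpha_k\rho_kT_k\frac{\mathrm{D}s_k}{\mathrm{D}t}=\mathcal{G}_k,\qquad k=1,\dots,N,$$ $$\mathcal{G}_k=\alpha_k\,\overline{\overline{\tau}}_k:\overline{\overline{D}}+\mathcal{Q}_k^{sum}+q_k+\mathcal{I}_k .$$ The terms in $\mathcal{G}_k$ are as follows. - Viscous stress: $\overline{\overline{D}}=\frac12\left[\nabla\boldsymbol{u}+(\nabla\boldsymbol{u})^{\mathrm T}\right]$ and $\overline{\overline{\tau}}_k=2\mu_k\overline{\overline{D}}+\left(\mu_{b,k}-\frac23\mu_k\right)(\nabla\cdot\boldsymbol{u})\,\overline{\overline{I}}$, where $\overline{\overline{I}}$ is the identity tensor, with shear viscosity $\mu_k>0$ and bulk viscosity $\mu_{b,k}>0$. - Temperature relaxation: $\mathcal{Q}_k^{sum}=\sum_{j\ne k}\mathcal{Q}_{jk}$ with $\mathcal{Q}_{jk}=\varsigma_{jk}(T_j-T_k)$ and $\varsigma_{jk}=\varsigma_{kj}>0$. - Heat conduction: $q_k=-\nabla\cdot\boldsymbol{q}_k$ with Fourier heat flux $\boldsymbol{q}_k=-\alpha_k\lambda_k\nabla T_k$ and heat conductivity $\lambda_k\ge 0$. - External heat source: $\mathcal{I}_k=\alpha_kI_k$ with $I_k\ge0$. *)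

(* Defs.v *)
From HB Require Import structures.
From mathcomp Require Import all_boot all_order all_algebra.
From mathcomp Require Import all_classical all_reals all_analysis.
Set Implicit Arguments.
Unset Strict Implicit.
Unset Printing Implicit Defensive.
Import Order.TTheory GRing.Theory Num.Theory.
Import numFieldNormedType.Exports.
Local Open Scope classical_set_scope.
Local Open Scope ring_scope.

(* Fields are functions of z = (t, x); they are only constrained on the open
   space-time region Om where the solution lives. *)
Notation spacetime R := (R * 'rV[R]_3)%type.

Fixpoint Cn (R : realType) (V W : normedModType R) (n : nat) (Om : set V)
    (f : V -> W) : Prop :=
  if n is n'.+1 then
    (forall z, Om z -> differentiable f z) /\
    (forall v : V, Cn n' Om (fun z => 'D_v f z))
  else forall z, Om z -> {for z, continuous f}.

Definition smooth (R : realType) (V W : normedModType R) (Om : set V)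
    (f : V -> W) : Prop := forall n, Cn n Om f.

Definition dt (R : realType) (f : spacetime R -> R) (z : spacetime R) : R :=
  'D_((1, 0) : spacetime R) f z.

Definition dx (R : realType) (i : 'I_3) (f : spacetime R -> R)
    (z : spacetime R) : R :=
  'D_((0, delta_mx 0 i) : spacetime R) f z.

Definition grad (R : realType) (f : spacetime R -> R) (z : spacetime R) :
    'rV[R]_3 := \row_i dx i f z.

Definition div (R : realType) (w : spacetime R -> 'rV[R]_3)
    (z : spacetime R) : R :=
  \sum_(i < 3) dx i (fun y => w y 0 i) z.

Definition gradv (R : realType) (w : spacetime R -> 'rV[R]_3)
    (z : spacetime R) : 'M[R]_3 :=
  \matrix_(i, j) dx i (fun y => w y 0 j) z.

Definition dotv (R : realType) (a b : 'rV[R]_3) : R :=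
  \sum_(i < 3) a 0 i * b 0 i.

Definition ddot (R : realType) (A B : 'M[R]_3) : R :=
  \sum_(i < 3) \sum_(j < 3) A i j * B i j.

Definition matD (R : realType) (u : spacetime R -> 'rV[R]_3)
    (f : spacetime R -> R) (z : spacetime R) : R :=
  dt f z + dotv (u z) (grad f z).

Record flow (R : realType) (N : nat) := Flow {
  vel : spacetime R -> 'rV[R]_3;
  pres : spacetime R -> R;
  alpha : 'I_N -> spacetime R -> R;
  rho : 'I_N -> spacetime R -> R;
  temp : 'I_N -> spacetime R -> R;
  energy : 'I_N -> spacetime R -> R;
  entropy : 'I_N -> spacetime R -> R }.

(* Coefficients and sources are arbitrary fields, which covers constants as
   well as dependence on the state. *)
Record data (R : realType) (N : nat) := Data {
  mu : 'I_N -> spacetime R -> R;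
  mub : 'I_N -> spacetime R -> R;
  varsigma : 'I_N -> 'I_N -> spacetime R -> R;
  lambda : 'I_N -> spacetime R -> R;
  heat_src : 'I_N -> spacetime R -> R }.

Definition mix_density (R : realType) (N : nat) (F : flow R N)
    (z : spacetime R) : R :=
  \sum_(k < N) alpha F k z * rho F k z.

Definition strain (R : realType) (N : nat) (F : flow R N)
    (z : spacetime R) : 'M[R]_3 :=
  2^-1 *: (gradv (vel F) z + (gradv (vel F) z)^T).

Definition stress (R : realType) (N : nat) (F : flow R N) (P : data R N)
    (k : 'I_N) (z : spacetime R) : 'M[R]_3 :=
  (2 * mu P k z) *: strain F z
  + ((mub P k z - 2 / 3 * mu P k z) * div (vel F) z)%:M.

Definition heat_transfer (R : realType) (N : nat) (F : flow R N)
    (P : data R N) (j k : 'I_N) (z : spacetime R) : R :=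
  varsigma P j k z * (temp F j z - temp F k z).

Definition heat_transfer_sum (R : realType) (N : nat) (F : flow R N)
    (P : data R N) (k : 'I_N) (z : spacetime R) : R :=
  \sum_(j < N | j != k) heat_transfer F P j k z.

Definition heat_flux (R : realType) (N : nat) (F : flow R N) (P : data R N)
    (k : 'I_N) (z : spacetime R) : 'rV[R]_3 :=
  - ((alpha F k z * lambda P k z) *: grad (temp F k) z).

Definition heat_cond (R : realType) (N : nat) (F : flow R N) (P : data R N)
    (k : 'I_N) (z : spacetime R) : R :=
  - div (heat_flux F P k) z.

Definition heat_ext (R : realType) (N : nat) (F : flow R N) (P : data R N)
    (k : 'I_N) (z : spacetime R) : R :=
  alpha F k z * heat_src P k z.

Definition entropy_source (R : realType) (N : nat) (F : flow R N)
    (P : data R N) (k : 'I_N) (z : spacetime R) : R :=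
  alpha F k z * ddot (stress F P k z) (strain F z)
  + heat_transfer_sum F P k z + heat_cond F P k z + heat_ext F P k z.

Record admissible_data (R : realType) (N : nat) (Om : set (spacetime R))
    (P : data R N) : Prop := AdmissibleData {
  mu_gt0 : forall k z, Om z -> 0 < mu P k z;
  mub_gt0 : forall k z, Om z -> 0 < mub P k z;
  varsigma_sym : forall j k z, Om z -> j != k ->
    varsigma P j k z = varsigma P k j z;
  varsigma_gt0 : forall j k z, Om z -> j != k -> 0 < varsigma P j k z;
  lambda_ge0 : forall k z, Om z -> 0 <= lambda P k z;
  heat_src_ge0 : forall k z, Om z -> 0 <= heat_src P k z }.

Record smooth_solution (R : realType) (N : nat) (Om : set (spacetime R))
    (F : flow R N) (P : data R N) : Prop := SmoothSolution {
  vel_smooth : smooth Om (vel F);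
  pres_smooth : smooth Om (pres F);
  alpha_smooth : forall k, smooth Om (alpha F k);
  rho_smooth : forall k, smooth Om (rho F k);
  temp_smooth : forall k, smooth Om (temp F k);
  energy_smooth : forall k, smooth Om (energy F k);
  entropy_smooth : forall k, smooth Om (entropy F k);
  (* automatic when the conductivity is differentiable, e.g. constant *)
  heat_flux_diff : forall k z, Om z -> differentiable (heat_flux F P k) z;
  alpha_gt0 : forall k z, Om z -> 0 < alpha F k z;
  alpha_sum1 : forall z, Om z -> \sum_(k < N) alpha F k z = 1;
  rho_gt0 : forall k z, Om z -> 0 < rho F k z;
  temp_gt0 : forall k z, Om z -> 0 < temp F k z;
  (* equality of differentials along the solution, evaluated at any
     space-time increment v *)
  gibbs : forall k z (v : spacetime R), Om z ->
    temp F k z * 'd (entropy F k) z v =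
    'd (energy F k) z v - pres F z / rho F k z ^+ 2 * 'd (rho F k) z v;
  mass_balance : forall k z, Om z ->
    dt (fun y => alpha F k y * rho F k y) z
    + div (fun y => (alpha F k y * rho F k y) *: vel F y) z = 0;
  entropy_balance : forall k z, Om z ->
    alpha F k z * rho F k z * temp F k z * matD (vel F) (entropy F k) z =
    entropy_source F P k z }.

(* Main.v *)
Require Import Defs.
From mathcomp Require Import all_boot all_order all_algebra.
From mathcomp Require Import all_classical all_reals all_analysis.
From mathcomp Require Import ring lra.
Set Implicit Arguments.
Unset Strict Implicit.
Unset Printing Implicit Defensive.
Import Order.TTheory GRing.Theory Num.Theory.
Import numFieldNormedType.Exports.
Local Open Scope classical_set_scope.
Local Open Scope ring_scope.

(** Mass conservation of every phase turns the material derivative of the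
    mass-averaged entropy into the sum of the [G_k / T_k].  Since
    [div (q_k / T_k) = div q_k / T_k + alpha_k lambda_k |grad T_k|^2 / T_k^2],
    removing the external part leaves, besides the conductive term and the
    external sources, [tau_k : D = 2 mu_k (D : D - (\tr D)^2 / 3) +
    mub_k (\tr D)^2], which is nonnegative by Cauchy-Schwarz, and the heat
    exchanges, which pair up as [varsigma_jk (T_j - T_k)^2 / (T_j T_k)]. *)

Section Calculus.
Context {R : realType}.
Implicit Types (f g : spacetime R -> R) (u w : spacetime R -> 'rV[R]_3).
Implicit Types (z : spacetime R).

(** * Product, quotient and sum rules for the material derivative and the divergence *)

Lemma dtM f g z : (forall v, derivable f z v) -> (forall v, derivable g z v) ->
  dt (fun y => f y * g y) z = f z * dt g z + g z * dt f z.
Proof. by move=> df dg; rewrite /dt (deriveM (df _) (dg _)). Qed.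

Lemma dxM i f g z :
  (forall v, derivable f z v) -> (forall v, derivable g z v) ->
  dx i (fun y => f y * g y) z = f z * dx i g z + g z * dx i f z.
Proof. by move=> df dg; rewrite /dx (deriveM (df _) (dg _)). Qed.

Lemma dxV i f z : f z != 0 -> (forall v, derivable f z v) ->
  dx i (fun y => (f y)^-1) z = - (f z) ^- 2 * dx i f z.
Proof. by move=> fz0 df; rewrite /dx (deriveV fz0 (df _)). Qed.

Lemma matDM u f g z :
  (forall v, derivable f z v) -> (forall v, derivable g z v) ->
  matD u (fun y => f y * g y) z = f z * matD u g z + g z * matD u f z.
Proof.
move=> df dg; rewrite /matD /dotv dtM // !mulrDr !mulr_sumr addrACA.
congr (_ + _); rewrite -big_split /=; apply: eq_bigr => i _.
by rewrite !mxE dxM //; ring.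
Qed.

Lemma matD_sum n u (f : 'I_n -> spacetime R -> R) z :
  (forall k v, derivable (f k) z v) ->
  matD u (fun y => \sum_(k < n) f k y) z = \sum_(k < n) matD u (f k) z.
Proof.
move=> df.
have D v : 'D_v (fun y => \sum_(k < n) f k y) z = \sum_(k < n) 'D_v (f k) z.
  by rewrite -derive_sum //; congr ('D_v _ z); apply/funext => y; rewrite fct_sumE.
rewrite /matD /dotv /dt D big_split /= exchange_big /=; congr (_ + _).
by apply: eq_bigr => i _; rewrite mxE /dx D mulr_sumr; apply: eq_bigr => k _; rewrite mxE.
Qed.

(** Derivatives depend only on germs, so identities that hold merely on an open region can be
    differentiated there. *)
Lemma near_eq_matD u f g z :
  (\near z, f z = g z) -> matD u f z = matD u g z.
Proof.
move=> fg; rewrite /matD /dotv /dt (near_eq_derive _ fg); congr (_ + _).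
by apply: eq_bigr => i _; rewrite !mxE /dx (near_eq_derive _ fg).
Qed.

Lemma differentiable_row w z i v :
  differentiable w z -> derivable (fun y => w y 0 i) z v.
Proof.
move=> dw; apply: diff_derivable.
exact: differentiable_comp dw (differentiable_coord (w z) 0 i).
Qed.

Lemma divZ f w z :
  (forall v, derivable f z v) -> differentiable w z ->
  div (fun y => f y *: w y) z = f z * div w z + dotv (w z) (grad f z).
Proof.
move=> df dw; rewrite /div /dotv mulr_sumr -big_split /=; apply: eq_bigr => i _.
under [X in dx i X]eq_fun do rewrite mxE.
by rewrite dxM ?mxE // => v; exact: differentiable_row.
Qed.

(** The product rule splits the flux divergence into [m z * div u z] and the advective term, which
    completes [dt m z] to a material derivative. *)
Lemma matD_mass u m z :
  (forall v, derivable m z v) -> differentiable u z ->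
  dt m z + div (fun y => m y *: u y) z = 0 ->
  matD u m z = - m z * div u z.
Proof. by move=> dm du; rewrite divZ // /matD => ?; lra. Qed.

(* The velocity divergence picked up by [m k] and by the total mass cancel. *)
Lemma matD_mass_average n (m e : 'I_n -> spacetime R -> R) u s z :
  (forall k v, derivable (m k) z v) -> (forall k v, derivable (e k) z v) ->
  differentiable u z ->
  (forall k, dt (m k) z + div (fun y => m k y *: u y) z = 0) ->
  (\near z, \sum_(k < n) m k z != 0) ->
  (\near z, (\sum_(k < n) m k z) * s z = \sum_(k < n) m k z * e k z) ->
  (\sum_(k < n) m k z) * matD u s z = \sum_(k < n) m k z * matD u (e k) z.
Proof.
move=> dm de du mass M0 sE; pose M y := \sum_(k < n) m k y.
have dM v : derivable M z v.
  rewrite (_ : M = \sum_(k < n) m k); first exact: derivable_sum.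
  by apply/funext => y; rewrite fct_sumE.
have dme k v : derivable (fun y => m k y * e k y) z v by exact: derivableM.
(* No regularity of [s] is assumed: it is inherited from the quotient of the two sums, which equals
   [s] near [z]. *)
have ds v : derivable s z v.
  pose S y := \sum_(k < n) m k y * e k y.
  have dS : derivable S z v.
    rewrite (_ : S = \sum_(k < n) (fun y => m k y * e k y)); first exact: derivable_sum.
    by apply/funext => y; rewrite fct_sumE.
  have dMV : derivable (fun y => (M y)^-1) z v.
    by apply: derivableV => //; exact: nbhs_singleton M0.
  apply: near_eq_derivable (derivableM dMV dS).
  near=> y; rewrite /GRing.mul /= -/(_ * _) /S -(near sE y) // mulrA mulVf ?mul1r //.
  exact: (near M0 y).
have := near_eq_matD u sE.
rewrite (matDM _ dM ds) !matD_sum //.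
have DMe k : matD u (fun y => m k y * e k y) z =
    m k z * matD u (e k) z - m k z * e k z * div u z.
  by rewrite matDM // (matD_mass (dm k)) //; ring.
rewrite (eq_bigr _ (fun k _ => DMe k)).
under [X in _ + s z * X]eq_bigr => k _ do rewrite (matD_mass (dm k)) //.
(* The two remaining multiples of [div u z] have coefficients [s z * M z] and the sum of the
   [m k z * e k z], equal by [sE] at [z]. *)
rewrite big_split /= sumrN -!mulr_suml sumrN -(nbhs_singleton sE).
by rewrite -/(M z) => ?; lra.
Unshelve. all: by end_near. Qed.

(** * Algebraic inequalities for tensors and symmetric exchanges *)

Lemma sqr_trace_le (A : 'M[R]_3) : (\tr A) ^+ 2 <= 3 * ddot A A.
Proof.
rewrite /mxtrace /ddot !big_ord_recl !big_ord0 /= !addr0.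
set a := A ord0 ord0; set b := A (lift _ _) (lift _ _); set c := A _ _.
(* The squared differences of the diagonal entries add up to 3 (a^2 + b^2 + c^2) - (a + b + c)^2;
   off-diagonal squares only enlarge the right-hand side. *)
have sq (x : R) : 0 <= x * x by exact: sqr_ge0.
have := sq (a - b); have := sq (a - c); have := sq (b - c).
nra.
Qed.

Lemma ddot_scalar (a : R) (A : 'M[R]_3) : ddot a%:M A = a * \tr A.
Proof.
rewrite /ddot mulr_sumr; apply: eq_bigr => i _.
rewrite (bigD1 i) //= mxE eqxx mulr1n big1 ?addr0 // => j ji.
by rewrite mxE eq_sym (negPf ji) mulr0n mul0r.
Qed.

Lemma ddotDl (A B C : 'M[R]_3) : ddot (A + B) C = ddot A C + ddot B C.
Proof.
rewrite /ddot -big_split /=; apply: eq_bigr => i _.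
by rewrite -big_split /=; apply: eq_bigr => j _; rewrite mxE mulrDl.
Qed.

Lemma ddotZl a (A B : 'M[R]_3) : ddot (a *: A) B = a * ddot A B.
Proof.
rewrite /ddot mulr_sumr; apply: eq_bigr => i _.
by rewrite mulr_sumr; apply: eq_bigr => j _; rewrite mxE mulrA.
Qed.

(** Single terms have no sign. Adding the double sum to its copy with exchanged indices collects, by
    symmetry of [c], each pair into a nonnegative square. *)
Lemma heat_exchange_ge0 n (c : 'I_n -> 'I_n -> R) (T : 'I_n -> R) :
  (forall j k, j != k -> c j k = c k j) ->
  (forall j k, j != k -> 0 <= c j k) ->
  (forall k, 0 < T k) ->
  0 <= \sum_(k < n) (T k)^-1 * \sum_(j < n | j != k) c j k * (T j - T k).
Proof.
move=> csym c0 T0; under eq_bigr do rewrite mulr_sumr.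
set S := \sum_(k < n) _.
have SE : S = \sum_(k < n) \sum_(j < n | j != k) (T j)^-1 * (c k j * (T k - T j)).
  rewrite /S (exchange_big_dep predT) //=; apply: eq_bigr => k _.
  by apply: eq_bigl => j; rewrite eq_sym.
suff : 0 <= S + S by move=> ?; lra.
rewrite {2}SE /S -big_split /= sumr_ge0 // => k _.
rewrite -big_split /= sumr_ge0 // => j jk.
rewrite (csym k j) 1?eq_sym //.
have -> : (T k)^-1 * (c j k * (T j - T k)) + (T j)^-1 * (c j k * (T k - T j)) =
    c j k * (T j - T k) ^+ 2 / (T j * T k).
  by field; rewrite !gt_eqF.
by apply: divr_ge0; apply: mulr_ge0; rewrite ?sqr_ge0 ?c0 // ltW.
Qed.
End Calculus.

(** * Viscous dissipation and conductive entropy flux of a phase *)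

Section Flow.
Context {R : realType} {N : nat}.
Variables (F : flow R N) (P : data R N).

Lemma trace_strain z : \tr (strain F z) = div (vel F) z.
Proof.
rewrite /strain mxtraceZ mxtraceD mxtrace_tr /mxtrace /gradv /div.
under eq_bigr do rewrite mxE.
by field.
Qed.

Lemma viscous_dissipation_ge0 k z :
  0 <= mu P k z -> 0 <= mub P k z -> 0 <= ddot (stress F P k z) (strain F z).
Proof.
move=> mu0 mub0; rewrite /stress ddotDl ddotZl ddot_scalar -trace_strain.
have := sqr_trace_le (strain F z).
set t := \tr _; set d := ddot _ _ => td.
(* The dissipation is 2/3 of this quantity plus [mub P k z * t ^+ 2]. *)
have : 0 <= mu P k z * (3 * d - t ^+ 2) by rewrite mulr_ge0 // subr_ge0.
have : 0 <= mub P k z * t ^+ 2 by rewrite mulr_ge0 // sqr_ge0.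
move=> ? ?; nra.
Qed.

(** The minus sign of Fourier's law meets the one in the gradient of 1/T, hence the plus sign of the
    quadratic term. *)
Lemma div_heat_flux_temp k z :
  temp F k z != 0 -> differentiable (temp F k) z ->
  differentiable (heat_flux F P k) z ->
  div (fun y => (temp F k y)^-1 *: heat_flux F P k y) z =
  - (temp F k z)^-1 * heat_cond F P k z +
  alpha F k z * lambda P k z * dotv (grad (temp F k) z) (grad (temp F k) z) /
    temp F k z ^+ 2.
Proof.
move=> T0 dT dq; have dT' v : derivable (temp F k) z v by exact: diff_derivable.
rewrite divZ //; last by move=> v; exact: derivableV.
rewrite /heat_cond mulrNN; congr (_ + _).
rewrite /dotv mulr_sumr mulr_suml; apply: eq_bigr => i _.
rewrite !mxE dxV //.
by ring.
Qed.

End Flow.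

Theorem proposition1 (R : realType) (N : nat) (Om : set (spacetime R))
    (F : flow R N) (P : data R N) (s Dext_s Dint_s : spacetime R -> R)
    (Om_open : open Om)
    (P_adm : admissible_data Om P)
    (F_sol : smooth_solution Om F P)
    (s_def : forall z, Om z ->
      mix_density F z * s z =
      \sum_(k < N) alpha F k z * rho F k z * entropy F k z)
    (split_def : forall z, Om z ->
      mix_density F z * matD (vel F) s z =
      mix_density F z * Dext_s z + mix_density F z * Dint_s z)
    (ext_def : forall z, Om z ->
      mix_density F z * Dext_s z =
      - \sum_(k < N)
          div (fun y => (temp F k y)^-1 *: heat_flux F P k y) z) :
  forall z, Om z -> 0 <= mix_density F z * Dint_s z.
Proof.
move=> z Oz.
have near_Om (Q : spacetime R -> Prop) : (forall y, Om y -> Q y) -> \near z, Q z.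
  by move=> OQ; apply: filterS OQ _; exact: open_nbhs_nbhs.
have diff (W : normedModType R) (f : spacetime R -> W) :
    smooth Om f -> differentiable f z.
  by move=> /(_ 1%N)[df _]; exact: df.
have T0 k : 0 < temp F k z by exact: (temp_gt0 F_sol).
have sum_gt0 y : Om y -> mix_density F y != 0.
  (* If the mixture density vanished, so would each of its nonnegative terms, hence every volume
     fraction, and their sum could not be 1. This also excludes [N = 0]. *)
  move=> Oy; apply: contra_eq_neq (alpha_sum1 F_sol Oy) => mix0.
  rewrite big1 => [|k _]; first by rewrite eq_sym oner_neq0.
  have m_ge0 j : 0 <= alpha F j y * rho F j y.
    by rewrite mulr_ge0 // ltW ?(alpha_gt0 F_sol) ?(rho_gt0 F_sol).
  have /eqP := psumr_eq0P (fun j _ => m_ge0 j) mix0 (i := k) isT.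
  by rewrite mulf_eq0 [rho F k y == 0]gt_eqF ?(rho_gt0 F_sol) // orbF => /eqP.
have avg : mix_density F z * matD (vel F) s z =
    \sum_(k < N) alpha F k z * rho F k z * matD (vel F) (entropy F k) z.
  apply: (matD_mass_average (m := fun k y => alpha F k y * rho F k y)).
  - move=> k v; apply: derivableM; apply: diff_derivable; apply: diff.
      exact: (alpha_smooth F_sol).
    exact: (rho_smooth F_sol).
  - by move=> k v; apply: diff_derivable; apply: diff; exact: (entropy_smooth F_sol).
  - by apply: diff; exact: (vel_smooth F_sol).
  - by move=> k; exact: (mass_balance F_sol).
  - exact: near_Om.
  - exact: near_Om.
(* In each phase, conduction divided by temperature cancels against the divergence of the entropy
   flux up to the gradient term. Heat exchanges are kept apart, being signed only after summation
   over the phases. *)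
have -> : mix_density F z * Dint_s z = \sum_(k < N)
    ((temp F k z)^-1 * (alpha F k z * ddot (stress F P k z) (strain F z))
     + alpha F k z * lambda P k z
         * dotv (grad (temp F k) z) (grad (temp F k) z) / temp F k z ^+ 2
     + (temp F k z)^-1 * heat_ext F P k z)
    + \sum_(k < N) (temp F k z)^-1 * heat_transfer_sum F P k z.
  have := split_def z Oz; rewrite ext_def // avg.
  move=> /esym/(canRL (addKr _)) ->; rewrite opprK -!big_split /=.
  apply: eq_bigr => k _.
  rewrite div_heat_flux_temp ?gt_eqF //; last 2 first.
  - by apply: diff; exact: (temp_smooth F_sol).
  - exact: (heat_flux_diff F_sol).
  have := entropy_balance F_sol k Oz.
  rewrite mulrAC => /(canRL (mulfK (lt0r_neq0 (T0 k)))) ->.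
  by rewrite /entropy_source; ring.
apply: addr_ge0; last first.
  apply: heat_exchange_ge0 => // j k jk.
  - exact: (varsigma_sym P_adm).
  - exact/ltW/(varsigma_gt0 P_adm).
apply: sumr_ge0 => k _.
have a0 : 0 <= alpha F k z by exact/ltW/(alpha_gt0 F_sol).
have TV0 : 0 <= (temp F k z)^-1 by rewrite invr_ge0 ltW.
have mu0 : 0 <= mu P k z by exact/ltW/(mu_gt0 P_adm).
have mub0 : 0 <= mub P k z by exact/ltW/(mub_gt0 P_adm).
have l0 : 0 <= lambda P k z by exact: (lambda_ge0 P_adm).
have I0 : 0 <= heat_src P k z by exact: (heat_src_ge0 P_adm).
have G0 : 0 <= dotv (grad (temp F k) z) (grad (temp F k) z).
  by apply: sumr_ge0 => i _; exact: sqr_ge0.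
rewrite !addr_ge0 ?divr_ge0 ?sqr_ge0 // !mulr_ge0 //.
exact: viscous_dissipation_ge0.
Qed.
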